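(* Let $p_X$ be an input density on $\mathcal{X}$, $x_0\in\mathcal{X}$, $p_{W|X}$ a channel from $\mathcal{X}$ to $\mathcal{W}$, and $p_W(w)=\int_{\mathcal{X}}p_X(x)p_{W|X}(w|x)\,dx$, with $p_W$ dominated by $p_{W|X=x_0}$. Let $n\ge1$ and $0<\epsilon_{\rm det}<1$. Consider testing, from an observation $\boldsymbol{w}\in\mathcal{W}^n$, the hypothesis $\mathcal{H}_0$ that $\boldsymbol{w}$ has density $\prod_{i=1}^n p_{W|X}(w_i|x_0)$ against the hypothesis $\mathcal{H}_1$ that $\boldsymbol{w}$ has density $\prod_{i=1}^n p_W(w_i)$, and let $\alpha$ and $\beta$ be the false detection and miss detection probabilities of an optimal test, i.e. one minimising $\alpha+\beta$. If $$\chi^2(p_W\parallel p_{W|X=x_0})\le\frac{4\xi^2\epsilon_{\rm det}^2}{n},\qquad \xi=e^{-\frac12\mathsf{W}_0(4\epsilon_{\rm det}^2)},$$ then $\alpha+\beta\ge 1-\epsilon_{\rm det}$. Moreover, $\frac{4\xi^2\epsilon_{\rm det}^2}{n}=\frac1n\left(4\epsilon_{\rm det}^2+\mathcal{O}(\epsilon_{\rm det}^4)\right)$ (as $\epsilon_{\rm det}\to0$).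
   Context: $\chi^2(p\parallel q)=\int\frac{(p(x)-q(x))^2}{q(x)}\,dx$ is the chi-squared distance. $\mathsf{W}_0$ is the principal branch of the Lambert W function (the inverse of $z\mapsto ze^z$ on $z\ge-1$). $\alpha$ is the probability of deciding $\mathcal{H}_1$ when $\mathcal{H}_0$ is true and $\beta$ is the probability of deciding $\mathcal{H}_0$ when $\mathcal{H}_1$ is true. ''$p_W$ is dominated by $p_{W|X=x_0}$'' means that $p_W(w)=0$ whenever $p_{W|X}(w|x_0)=0$. *)

(* Defs.v *)
From HB Require Import structures.
From mathcomp Require Import all_boot all_order all_algebra.
From mathcomp Require Import all_classical all_reals all_analysis.

Set Implicit Arguments.
Unset Strict Implicit.
Unset Printing Implicit Defensive.

Import Order.TTheory GRing.Theory Num.Theory.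
Import numFieldNormedType.Exports.

Local Open Scope classical_set_scope.
Local Open Scope ring_scope.

Definition tuple_cons d (T : measurableType d) n (x : T * n.-tuple T)
  : n.+1.-tuple T := [tuple of x.1 :: x.2].

Lemma measurable_tuple_cons d (T : measurableType d) n :
  measurable_fun [set: T * n.-tuple T] (@tuple_cons d T n).
Proof. exact: measurable_cons. Qed.

Section cons_measure.
Context d (T : measurableType d) (R : realType) (n : nat).
Variable mu : {sigma_finite_measure set T -> \bar R}.
Variable nu : {sigma_finite_measure set (n.-tuple T) -> \bar R}.

Definition cons_measure : set (n.+1.-tuple T) -> \bar R :=
  pushforward (mu \x nu)%E (@tuple_cons d T n).

Let sigma_finite_product : sigma_finite setT (mu \x nu)%E.
Proof.
have /sigma_finiteP[F [TF ndF Foo]] := sigma_finiteT mu.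
have /sigma_finiteP[G [TG ndG Goo]] := sigma_finiteT nu.
exists (fun k => F k `*` G k).
  rewrite -setXTT TF TG predeqE => -[x y]; split.
    move=> [/= [i _ Fix] [k _ Gky]]; exists (maxn i k) => //; split.
      by move: x Fix; exact/subsetPset/ndF/leq_maxl.
    by move: y Gky; exact/subsetPset/ndG/leq_maxr.
  by move=> [i _ []/= ? ?]; split; exists i.
move=> k; have [? ?] := Foo k; have [? ?] := Goo k.
split; first exact: measurableX.
by rewrite product_measure1E// lte_mul_pinfty// ge0_fin_numE.
Qed.

Let preim_measurable (A : set (n.+1.-tuple T)) :
  measurable A -> measurable (@tuple_cons d T n @^-1` A).
Proof.
by move=> mA; rewrite -[X in measurable X]setTI; exact: measurable_tuple_cons.
Qed.

Let cons_measure0 : cons_measure set0 = 0%E.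
Proof. by rewrite /cons_measure /pushforward preimage_set0 measure0. Qed.

Let cons_measure_ge0 A : (0 <= cons_measure A)%E.
Proof. by apply: integral_ge0 => x _; exact: measure_ge0. Qed.

Let cons_measure_sigma_additive : semi_sigma_additive cons_measure.
Proof.
move=> F mF tF mUF; rewrite /cons_measure /pushforward preimage_bigcup.
apply: measure_semi_sigma_additive.
- by move=> k; exact: preim_measurable.
- apply/trivIsetP => /= i j _ _ ij; rewrite -preimage_setI.
  by move/trivIsetP : tF => /(_ _ _ _ _ ij) ->//; rewrite preimage_set0.
- by rewrite -preimage_bigcup; exact: preim_measurable.
Qed.

HB.instance Definition _ := isMeasure.Build _ _ _
  cons_measure cons_measure0 cons_measure_ge0 cons_measure_sigma_additive.

Let cons_measure_sigma_finite : sigma_finite setT cons_measure.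
Proof.
have [F FT mF] := sigma_finite_product.
pose h (w : n.+1.-tuple T) : T * n.-tuple T := (thead w, [tuple of behead w]).
have Kh x : h (tuple_cons x) = x.
  by case: x => x w; congr pair; exact/val_inj.
have mh : measurable_fun setT h.
  apply: measurable_fun_pair; last exact: measurable_behead.
  exact: (@measurable_tnth _ T n.+1 ord0).
exists (fun k => h @^-1` F k).
  by rewrite -preimage_bigcup -FT preimage_setT.
move=> k; have [mFk Fkoo] := mF k; split.
  by rewrite -[X in measurable X]setTI; exact: mh.
rewrite /cons_measure /pushforward -comp_preimage.
rewrite (_ : h \o _ = id) ?preimage_id//.
by apply/funext => x /=; rewrite Kh.
Qed.

HB.instance Definition _ := Measure_isSigmaFinite.Build _ _ _ cons_measure
  cons_measure_sigma_finite.

End cons_measure.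

(* The product measure [mu^n] on [T^n]; on the one-point space [T^0] it is the
   unit mass. *)
Fixpoint tuple_measure d (T : measurableType d) (R : realType)
    (mu : {sigma_finite_measure set T -> \bar R}) (n : nat) :
    {sigma_finite_measure set (n.-tuple T) -> \bar R} :=
  match n with
  | 0 => \d_([tuple] : 0.-tuple T)
  | n'.+1 => cons_measure mu (tuple_measure mu n')
  end.

Lemma tuple_measureE d (T : measurableType d) (R : realType)
    (mu : {sigma_finite_measure set T -> \bar R}) (n : nat)
    (A : 'I_n -> set T) : (forall i, measurable (A i)) ->
  tuple_measure mu n [set w | forall i, A i (tnth w i)] =
  (\prod_(i < n) mu (A i))%E.
Proof.
elim: n A => [|n IHn] A mA.
  rewrite big_ord0 /= diracE mem_set//= => -[].
  by move.
have mA' : measurable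
    [set w : n.-tuple T | forall i, A (lift ord0 i) (tnth w i)].
  rewrite (_ : mkset _ = \bigcap_(i in [set: 'I_n])
      ((@tnth n T ^~ i) @^-1` A (lift ord0 i))).
    apply: fin_bigcap_measurable => [|i _]; first exact: finite_finset.
    by rewrite -[X in measurable X]setTI; exact: measurable_tnth.
  by apply/seteqP; split => w /= H i; [move=> _|]; exact: H.
rewrite big_ord_recl -IHn//= -product_measure1E//.
rewrite /cons_measure /pushforward; congr (product_measure1 _ _ _).
apply/seteqP; split => -[x w] /=.
  move=> H; split; first exact: (H ord0).
  by move=> i; have := H (lift ord0 i); rewrite /tuple_cons tnthS.
move=> [Ax Aw] i; case: (unliftP ord0 i) => [j ->|-> //].
by rewrite /tuple_cons tnthS.
Qed.

Definition is_density d (T : measurableType d) (R : realType)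
    (mu : {measure set T -> \bar R}) (p : T -> R) : Prop :=
  [/\ measurable_fun [set: T] p, (forall x, 0 <= p x) &
      (\int[mu]_x (p x)%:E = 1)%E].

(* [p x w] is the conditional density [p (w | x)]; joint measurability is what
   makes the output density well defined and measurable. *)
Definition is_channel d1 d2 (X : measurableType d1) (W : measurableType d2)
    (R : realType) (muW : {measure set W -> \bar R}) (p : X -> W -> R) : Prop :=
  measurable_fun [set: X * W] (fun xw => p xw.1 xw.2) /\
  (forall x, is_density muW (p x)).

(* Extended-real valued, since the integral may diverge on a null set. *)
Definition output_density d1 d2 (X : measurableType d1) (W : measurableType d2)
    (R : realType) (muX : {measure set X -> \bar R})
    (pX : X -> R) (pWX : X -> W -> R) (w : W) : \bar R :=
  (\int[muX]_x (pX x * pWX x w)%:E)%E.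

Definition dominated_density (W : Type) (R : realType) (p q : W -> \bar R)
    : Prop :=
  forall w, q w = 0%E -> p w = 0%E.

(* In [\bar R], [0^-1 = +oo] and [0 * +oo = 0]: where [q] vanishes the integrand
   is [0] if [p] vanishes too, and [+oo] otherwise. *)
Definition chi2 d (W : measurableType d) (R : realType)
    (mu : {measure set W -> \bar R}) (p q : W -> \bar R) : \bar R :=
  (\int[mu]_w ((p w - q w) ^+ 2 / q w))%E.

Definition iid_density (W : Type) (R : realType) (n : nat) (p : W -> \bar R)
    (w : n.-tuple W) : \bar R :=
  (\prod_(i < n) p (tnth w i))%E.

(* A (possibly randomised) test: [phi w] is the probability of deciding [H1]
   upon observing [w]; deterministic tests are the indicators. *)
Definition is_test d (W : measurableType d) (R : realType) (phi : W -> R)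
    : Prop :=
  measurable_fun [set: W] phi /\ (forall w, 0 <= phi w <= 1).

Section error_probabilities.
Context d (W : measurableType d) (R : realType).
Variable mu : {measure set W -> \bar R}.
Variables f0 f1 : W -> \bar R.

Definition false_detection (phi : W -> R) : \bar R :=
  (\int[mu]_w ((phi w)%:E * f0 w))%E.

Definition miss_detection (phi : W -> R) : \bar R :=
  (\int[mu]_w ((1 - phi w)%:E * f1 w))%E.

Definition optimal_test (phi : W -> R) : Prop :=
  is_test phi /\
  forall psi : W -> R, is_test psi ->
    (false_detection phi + miss_detection phi <=
     false_detection psi + miss_detection psi)%E.

End error_probabilities.

Section lambert.
Context (R : realType).

(* The default value [0] is only taken for [y < - e^-1], where no [z] exists. *)
Definition lambertW0 (y : R) : R :=
  xget 0 [set z | -1 <= z /\ z * expR z = y].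

Definition xi (eps : R) : R := expR (- 2^-1 * lambertW0 (4 * eps ^+ 2)).

End lambert.

(* Main.v *)
(* Write a, b for the two product densities and w = W0 (4 eps^2), so that the
   hypothesis reads chi2 <= w / n and w e^w = 4 eps^2. For any test, with
   probability t of deciding H1,
     t a + (1 - t) b >= (a + b)/2 - |a - b|/2
                     >= (a + b)/2 - (a - b)^2 / (8 eps a) - eps a / 2,
   whose integral is 1 - chi2_n / (8 eps) - eps / 2. Tensorization gives
     1 + chi2_n = (1 + chi2)^n <= (1 + w/n)^n <= e^w <= 1 + w e^w
                = 1 + 4 eps^2,
   hence the bound 1 - eps. The expansion follows from
   4 xi^2 eps^2 = w and 0 <= y - W0 y = W0 y (e^(W0 y) - 1) <= y^2. *)

Require Import Defs.
From HB Require Import structures.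
From mathcomp Require Import all_boot all_order all_algebra.
From mathcomp Require Import all_classical all_reals all_analysis.
From mathcomp Require Import measurable_realfun ring lra.

Set Implicit Arguments.
Unset Strict Implicit.
Unset Printing Implicit Defensive.

Import Order.TTheory GRing.Theory Num.Theory.
Import numFieldNormedType.Exports.

Local Open Scope classical_set_scope.
Local Open Scope ring_scope.

(** * The Lambert function on nonnegative reals *)

Section lambertW0_theory.
Context (R : realType).

(** The intermediate value theorem applies on [[0, y]] because [0 <= y <= y * expR y]; hence [xget]
    returns a genuine solution. *)
Lemma lambertW0K (y : R) : 0 <= y -> lambertW0 y * expR (lambertW0 y) = y.
Proof.
move=> y0.
suff [] : [set z | -1 <= z /\ z * expR z = y] (lambertW0 y) by [].
rewrite /lambertW0; apply: xgetPex.
have [||z] := @IVT _ (fun z => z * expR z) 0 y y y0.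
- apply: continuous_subspaceT => z; apply: cvgM; first exact: cvg_id.
  exact: continuous_expR.
- rewrite mul0r min_l ?max_r ?mulr_ge0 ?expR_ge0// y0/=.
  by rewrite ler_peMr// -expR0 ler_expR.
rewrite in_itv/= => /andP[z0 _] zy; exists z; split => //.
by rewrite (le_trans _ z0)// lerN10.
Qed.

Lemma lambertW0_ge0 (y : R) : 0 <= y -> 0 <= lambertW0 y.
Proof.
by move=> y0; rewrite -(pmulr_lge0 _ (expR_gt0 (lambertW0 y))) lambertW0K.
Qed.

Lemma lambertW0_le (y : R) : 0 <= y -> lambertW0 y <= y.
Proof.
by move=> y0; rewrite -{2}(lambertW0K y0) ler_peMr ?lambertW0_ge0// -expR0 ler_expR
  lambertW0_ge0.
Qed.

(** Multiply [1 - w <= expR (- w)] by [expR w] and use [w * expR w = y]. *)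
Lemma expR_lambertW0 (y : R) : 0 <= y -> expR (lambertW0 y) <= 1 + y.
Proof.
move=> y0; rewrite -{2}(lambertW0K y0); set w := lambertW0 y.
have := expR_ge1Dx (- w); rewrite -(ler_pM2r (expR_gt0 w)).
by rewrite -expRD addNr expR0; lra.
Qed.

(** With [w] the right-hand side, [xi e ^+ 2] is [expR (- w)], which cancels the exponential in
    [4 * e ^+ 2 = w * expR w]. *)
Lemma xi_lambertW0 (e : R) :
  4 * xi e ^+ 2 * e ^+ 2 = lambertW0 (4 * e ^+ 2).
Proof.
have y0 : 0 <= 4 * e ^+ 2 by rewrite mulr_ge0// sqr_ge0.
rewrite mulrAC -[X in X * _](lambertW0K y0) /xi -expRM_natr -mulrA -expRD.
by rewrite (_ : _ + _ = 0) ?expR0 ?mulr1//; lra.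
Qed.

Lemma lambertW0_quad (y : R) : 0 <= y -> `|lambertW0 y - y| <= y ^+ 2.
Proof.
move=> y0; rewrite distrC ger0_norm ?subr_ge0 ?lambertW0_le//.
have w0 := lambertW0_ge0 y0; have wy := lambertW0_le y0.
(* With [w] the Lambert value, this reads [y <= w * (1 + y)], so [y - w <= w * y]; then [w <= y]
   concludes. *)
have := ler_wpM2l w0 (expR_lambertW0 y0); rewrite lambertW0K//.
by have := ler_wpM2r y0 wy; rewrite expr2; lra.
Qed.

End lambertW0_theory.

(** * Pointwise inequalities and identities for the integrands *)

Section pointwise.
Context (R : realType).

(* [g] stands for [b ^+ 2 / a]; the product form of the hypothesis also covers
   [a = 0], and everything is arranged so that no subtraction of possibly
   infinite quantities occurs in the extended version [etest_am_gm]. *)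
Lemma test_am_gm (a b g t e : R) : 0 < e -> 0 <= a -> 0 <= t <= 1 ->
  0 <= g -> b ^+ 2 = g * a ->
  2^-1 * a + (2^-1 + (4 * e)^-1) * b <=
  t * a + (1 - t) * b + (8 * e)^-1 * g + ((8 * e)^-1 + e / 2) * a.
Proof.
move=> e0 a0 /andP[t0 t1] g0 bga.
move: a0; rewrite le_eqVlt => /predU1P[a0|a0].
  move: bga; rewrite -a0 mulr0 => /eqP; rewrite sqrf_eq0 => /eqP ->.
  by rewrite !mulr0 !addr0 add0r mulr_ge0// invr_ge0; lra.
have -> : g = b ^+ 2 / a by rewrite bga mulfK// gt_eqF.
rewrite -subr_ge0.
(* Completing the square in [a - b] leaves [(2 * e * a) ^+ 2] times
   [1 - (2 * t - 1) ^+ 2 = 4 * t * (1 - t)]. *)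
rewrite (_ : _ - _ = ((a - b + 2 * e * a * (2 * t - 1)) ^+ 2 +
    (2 * e * a) ^+ 2 * (4 * t * (1 - t))) / (8 * e * a)); last first.
  by field; rewrite !gt_eqF.
rewrite divr_ge0 ?addr_ge0 ?sqr_ge0//; last by rewrite !mulr_ge0 ?ltW.
by rewrite mulr_ge0 ?sqr_ge0 ?mulr_ge0 ?subr_ge0.
Qed.

Local Open Scope ereal_scope.

Lemma etest_am_gm (a t e : R) (b g : \bar R) :
  (0 < e)%R -> (0 <= a)%R -> (0 <= t <= 1)%R -> 0 <= b -> 0 <= g ->
  b ^+ 2 = g * a%:E ->
  (2^-1)%:E * a%:E + (2^-1 + (4 * e)^-1)%:E * b <=
  t%:E * a%:E + (1 - t)%:E * b + (8 * e)^-1%:E * g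
   + ((8 * e)^-1 + e / 2)%:E * a%:E.
Proof.
move=> e0 a0 /[dup] /andP[t0 t1] t01.
have k0 : (0 < (8 * e)^-1)%R by rewrite invr_gt0; lra.
have t'0 : (0 <= 1 - t)%R by lra.
have l0 : (0 <= ((8 * e)^-1 + e / 2) * a)%R.
  by rewrite mulr_ge0// addr_ge0 ?divr_ge0// ltW.
(* An infinite [g] makes the right-hand side [+oo]. *)
case: g => [g| |//]; last first.
  move=> b0 _ _; rewrite (gt0_muley (x := _%:E)) ?lte_fin//.
  rewrite addey ?addye ?leey//.
  by rewrite gt_eqF// (lt_le_trans ltNy0)// adde_ge0 ?mule_ge0// lee_fin ?mulr_ge0.
(* With [g] finite, [b = +oo] would contradict [b ^+ 2 = g * a%:E]. *)
case: b => [b| |//]; last by rewrite expe2 mulyy -EFinM.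
rewrite expe2 -!EFinM -!EFinD !lee_fin => _ g0 [bga].
exact: test_am_gm.
Qed.

(** The square is expanded with the cross term kept on the left, so that for [0 < q] and [p = +oo]
    both sides are [+oo]. At [q = 0], domination gives [p = 0], which absorbs [0^-1 = +oo]. *)
Lemma chi2_integrandE (p : \bar R) (q : R) :
  (0 <= q)%R -> 0 <= p -> (q%:E = 0 -> p = 0) ->
  (p - q%:E) ^+ 2 / q%:E + 2%:E * p = p ^+ 2 / q%:E + q%:E.
Proof.
rewrite le_eqVlt => /predU1P[<- _ /(_ erefl) ->|q0 p0 _].
  by rewrite sube0 expe2 !mul0e mule0.
rewrite inver gt_eqF//.
case: p p0 => [p| |//] _.
  rewrite -EFinB !expe2 -!EFinM -!EFinD; congr EFin; field.
  by rewrite gt_eqF.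
by rewrite addye// expe2 mulyy gt0_mulye ?gt0_muley ?lte_fin ?invr_gt0.
Qed.

Lemma sqr_divK (p : \bar R) (q : R) :
  (0 <= q)%R -> 0 <= p -> (q%:E = 0 -> p = 0) ->
  p ^+ 2 = p ^+ 2 / q%:E * q%:E.
Proof.
rewrite le_eqVlt => /predU1P[<- _ /(_ erefl) ->|q0 p0 _].
  by rewrite mule0 expe2 mule0.
by rewrite -muleA mulVe ?mule1// gt_eqF// lte_fin.
Qed.

End pointwise.

(** * Measurability of inverses and products *)

Section measurability.
Context d (T : measurableType d) (R : realType).
Local Open Scope ereal_scope.

Lemma measurable_inve_ge0 (f : T -> R) : (forall x, (0 <= f x)%R) ->
  measurable_fun [set: T] f ->
  measurable_fun [set: T] (fun x => (f x)%:E^-1).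
Proof.
move=> f0 mf.
(* The extended inverse is a real power off the zero set of [f] and [+oo] on it. *)
rewrite (_ : (fun x => _) =
  (fun x => if f x == 0%R then +oo else (f x `^ (-1))%:E)).
  apply: measurable_fun_ifT => //; first exact: measurable_fun_eqr.
  by apply/measurable_EFinP; exact: (measurableT_comp (measurable_powR _)).
by apply/funext => x; rewrite inver powR_inv1.
Qed.

Lemma emeasurable_prod (I : Type) (s : seq I) (h : I -> T -> \bar R) :
  (forall i, measurable_fun [set: T] (h i)) ->
  measurable_fun [set: T] (fun x => \prod_(i <- s) h i x).
Proof.
move=> mh; elim: s => [|i s IHs].
  by under eq_fun do rewrite big_nil; exact: measurable_cst.
by under eq_fun do rewrite big_cons; exact: emeasurable_funM.
Qed.

End measurability.

Lemma measurable_iid_density d (T : measurableType d) (R : realType) n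
    (h : T -> \bar R) :
  measurable_fun [set: T] h -> measurable_fun [set: n.-tuple T] (iid_density h).
Proof.
move=> mh; apply: (emeasurable_prod _ (h := fun i w => h (tnth w i))) => i.
exact: (measurableT_comp mh (measurable_tnth i)).
Qed.

(** * Integrals of product functions over the product measure *)

Section tensorization.
Context d (T : measurableType d) (R : realType).
Variable mu : {sigma_finite_measure set T -> \bar R}.
Local Open Scope ereal_scope.

(** Induction on the first coordinate: change of variables along [tuple_cons], then Tonelli. It
    serves both to normalise the product densities and to tensorize the second moment of the
    likelihood ratio. *)
Lemma integral_iid_density n (h : T -> \bar R) :
  measurable_fun [set: T] h -> (forall x, 0 <= h x) ->
  \int[tuple_measure mu n]_w iid_density h w = (\int[mu]_x h x) ^+ n.
Proof.
move=> mh h0.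
have iid_ge0 m (w : m.-tuple T) : 0 <= iid_density h w.
  by apply: prode_ge0 => i _.
elim: n => [|n IHn].
  rewrite /= integral_dirac//; last exact: measurable_iid_density.
  by rewrite diracT mul1e /iid_density big_ord0.
have iidS (x : T) (w : n.-tuple T) :
    iid_density h (tuple_cons (x, w)) = h x * iid_density h w.
  rewrite /iid_density big_ord_recl; congr (_ * _).
  by apply: eq_bigr => i _; rewrite /tuple_cons tnthS.
rewrite expeS [LHS](ge0_integral_pushforward (@measurable_tuple_cons _ T n))//;
  last exact: measurable_iid_density.
rewrite preimage_setT fubini_tonelli1//=; last first.
  apply: measurableT_comp; last exact: measurable_tuple_cons.
  exact: measurable_iid_density.
rewrite /fubini_F /=.
under eq_integral => x _.
  under eq_integral do rewrite iidS.
  rewrite ge0_integralZl//; last exact: measurable_iid_density.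
  over.
by rewrite /= ge0_integralZr// IHn ?expe_ge0 ?integral_ge0.
Qed.

End tensorization.

Lemma lee_expe2r (R : realDomainType) n (x y : \bar R) :
  (0 <= x)%E -> (x <= y)%E -> (x ^+ n <= y ^+ n)%E.
Proof.
move=> x0 xy; elim: n => [|n IHn]; first by rewrite !expe0.
by rewrite !expeS lee_pmul// expe_ge0.
Qed.

Lemma expe1n (R : numDomainType) n : (1 ^+ n = 1 :> \bar R)%E.
Proof. by elim: n => [|n IHn]; rewrite ?expe0// expeS mul1e. Qed.

(** * From a second-moment bound to a bound on the error sum *)

Section chi2_test_bound.
Context d (T : measurableType d) (R : realType).
Local Open Scope ereal_scope.

Lemma integral_sqr_div (mu : {measure set T -> \bar R}) (p : T -> \bar R)
    (q : T -> R) :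
  measurable_fun [set: T] p -> (forall x, 0 <= p x) ->
  is_density mu q -> \int[mu]_x p x = 1 ->
  dominated_density p (fun x => (q x)%:E) ->
  \int[mu]_x (p x ^+ 2 / (q x)%:E) = chi2 mu p (fun x => (q x)%:E) + 1.
Proof.
move=> mp p0 [mq q0 q1] p1 pq.
have mq' : measurable_fun [set: T] (fun x => (q x)%:E) by exact/measurable_EFinP.
have mV := measurable_inve_ge0 q0 mq.
have sqr_div_ge0 (r : T -> \bar R) x : 0 <= r x ^+ 2 / (q x)%:E.
  by rewrite mule_ge0 ?sqre_ge0// inve_ge0 lee_fin.
have m_sqr_div (r : T -> \bar R) : measurable_fun [set: T] r ->
    measurable_fun [set: T] (fun x => r x ^+ 2 / (q x)%:E).
  move=> mr; apply: emeasurable_funM => //.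
  by under eq_fun do rewrite expe2; exact: emeasurable_funM.
have : \int[mu]_x ((p x - (q x)%:E) ^+ 2 / (q x)%:E + 2%:E * p x) =
    \int[mu]_x (p x ^+ 2 / (q x)%:E + (q x)%:E).
  by apply: eq_integral => x _; exact: chi2_integrandE (q0 x) (p0 x) (pq x).
rewrite ge0_integralD//; last 4 first.
- by move=> x _; exact: (sqr_div_ge0 (fun x => p x - (q x)%:E)).
- exact: (m_sqr_div (fun x => p x - (q x)%:E) (emeasurable_funB mp mq')).
- by move=> x _; rewrite mule_ge0.
- exact: measurable_funeM.
rewrite -[X in X + _]/(chi2 mu p _) ge0_integralZl// p1 mule1.
rewrite ge0_integralD ?q1//; last 2 first.
- exact: m_sqr_div.
- by move=> x _; rewrite lee_fin.
(* Integration gave chi-squared plus 2 on the left and the second moment plus 1 on the right;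
   subtracting the finite 1 is safe even if both are infinite. *)
move=> /(congr1 (fun z => z - 1)).
by rewrite addeK// -addeA -EFinB => <-; congr (_ + _%:E); lra.
Qed.

(** Here [g] plays the role of [f1 ^+ 2 / f0], so the bound on its integral says that chi-squared is
    at most [4 * e ^+ 2]. The conclusion comes from integrating [etest_am_gm]. *)
Lemma chi2_error_bound (mu : {measure set T -> \bar R}) (f0 : T -> R)
    (f1 g : T -> \bar R) (phi : T -> R) (e : R) :
  (0 < e)%R -> is_test phi -> is_density mu f0 ->
  measurable_fun [set: T] f1 -> (forall x, 0 <= f1 x) -> \int[mu]_x f1 x = 1 ->
  measurable_fun [set: T] g -> (forall x, 0 <= g x) ->
  (forall x, f1 x ^+ 2 = g x * (f0 x)%:E) ->
  \int[mu]_x g x <= (1 + 4 * e ^+ 2)%:E ->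
  (1 - e)%:E <= false_detection mu (EFin \o f0) phi + miss_detection mu f1 phi.
Proof.
move=> e0 [mphi phi01] [mf0 f00 f0int] mf1 f10 f1int mg g0 f1g gint.
have mf0' : measurable_fun [set: T] (fun x => (f0 x)%:E).
  exact/measurable_EFinP.
have f00' x : 0 <= (f0 x)%:E by rewrite lee_fin.
have mphi' : measurable_fun [set: T] (fun x => (phi x)%:E).
  exact/measurable_EFinP.
have mphi1 : measurable_fun [set: T] (fun x => (1 - phi x)%:E).
  by apply/measurable_EFinP; exact: measurable_funB.
have phi0 x : 0 <= (phi x)%:E by rewrite lee_fin; case/andP: (phi01 x).
have phi1 x : 0 <= (1 - phi x)%:E.
  by rewrite lee_fin subr_ge0; case/andP: (phi01 x).
have k10 : (0 <= (8 * e)^-1)%R by rewrite invr_ge0; lra.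
have k20 : (0 <= (8 * e)^-1 + e / 2)%R by rewrite addr_ge0// divr_ge0// ltW.
have k30 : (0 <= 2^-1 + (4 * e)^-1)%R by rewrite addr_ge0// invr_ge0; lra.
have le_int : \int[mu]_x ((2^-1)%:E * (f0 x)%:E +
      (2^-1 + (4 * e)^-1)%:E * f1 x) <=
    \int[mu]_x ((phi x)%:E * (f0 x)%:E + (1 - phi x)%:E * f1 x +
      (8 * e)^-1%:E * g x + ((8 * e)^-1 + e / 2)%:E * (f0 x)%:E).
  apply: ge0_le_integral => //.
  - by move=> x _; rewrite adde_ge0 ?mule_ge0.
  - by apply: emeasurable_funD; exact: measurable_funeM.
  - apply: emeasurable_funD; last exact: measurable_funeM.
    apply: emeasurable_funD; last exact: measurable_funeM.
    by apply: emeasurable_funD; exact: emeasurable_funM.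
  - by move=> x _; apply: etest_am_gm.
have mA : measurable_fun [set: T] (fun x => (phi x)%:E * (f0 x)%:E).
  exact: emeasurable_funM.
have mB : measurable_fun [set: T] (fun x => (1 - phi x)%:E * f1 x).
  exact: emeasurable_funM.
have A0 x : 0 <= (phi x)%:E * (f0 x)%:E by rewrite mule_ge0.
have B0 x : 0 <= (1 - phi x)%:E * f1 x by rewrite mule_ge0.
move: le_int; rewrite ge0_integralD//; last 4 first.
- by move=> x _; rewrite mule_ge0.
- exact: measurable_funeM.
- by move=> x _; rewrite mule_ge0.
- exact: measurable_funeM.
rewrite ge0_integralD//; last 4 first.
- by move=> x _; rewrite !adde_ge0 ?mule_ge0.
- apply: emeasurable_funD; last exact: measurable_funeM.
  exact: emeasurable_funD.
- by move=> x _; rewrite mule_ge0.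
- exact: measurable_funeM.
rewrite ge0_integralD//; last 4 first.
- by move=> x _; rewrite adde_ge0.
- exact: emeasurable_funD.
- by move=> x _; rewrite mule_ge0.
- exact: measurable_funeM.
rewrite ge0_integralD// !ge0_integralZl// f0int f1int !mule1.
rewrite -/(miss_detection mu f1 phi).
rewrite -/(false_detection mu (EFin \o f0) phi).
set E := false_detection _ _ _ + _ => leE.
have : (2^-1 + (2^-1 + (4 * e)^-1))%:E <=
    E + ((8 * e)^-1 * (1 + 4 * e ^+ 2) + ((8 * e)^-1 + e / 2))%:E.
  apply: (le_trans leE); rewrite [in leRHS]EFinD addeA leeD2r// leeD2l//.
  by rewrite EFinM lee_wpmul2l.
(* The multiples of [e^-1] cancel; the loss [e] is [e / 2] from the second moment plus [e / 2] from
   the last term of [etest_am_gm]. *)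
rewrite -leeBlDr// -EFinB; congr (_%:E <= _).
by field; rewrite gt_eqF.
Qed.

End chi2_test_bound.

(** This is the [n]-th power of [1 + w / n <= expR (w / n)]. *)
Lemma expr_1Ddivn_le (R : realType) (w : R) n :
  0 <= w -> (0 < n)%N -> (1 + w / n%:R) ^+ n <= expR w.
Proof.
move=> w0 n0; rewrite -[X in expR X](@divfK _ n%:R) ?pnatr_eq0 -?lt0n//.
rewrite expRM_natr lerXn2r ?nnegrE ?expR_ge0 ?expR_ge1Dx//.
by rewrite addr_ge0// divr_ge0.
Qed.

(** * The output density is a probability density, by Tonelli *)

Section output_density_theory.
Context dX dW (X : measurableType dX) (W : measurableType dW) (R : realType).
Variables (muX : {sigma_finite_measure set X -> \bar R}).
Variables (muW : {sigma_finite_measure set W -> \bar R}).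
Variables (pX : X -> R) (pWX : X -> W -> R).
Hypotheses (dpX : is_density muX pX) (cpWX : is_channel muW pWX).
Local Open Scope ereal_scope.

Let joint (xw : X * W) : \bar R := (pX xw.1 * pWX xw.1 xw.2)%:E.

Let measurable_joint : measurable_fun [set: X * W] joint.
Proof.
case: dpX cpWX => mpX _ _ [mpWX _]; apply/measurable_EFinP.
by apply: measurable_funM => //; exact: (measurableT_comp mpX).
Qed.

Let joint_ge0 xw : 0 <= joint xw.
Proof.
case: dpX cpWX => _ pX0 _ [_ /(_ xw.1)[_ pWX0 _]].
by rewrite lee_fin mulr_ge0.
Qed.

Lemma measurable_output_density :
  measurable_fun [set: W] (output_density muX pX pWX).
Proof.
exact: (measurable_fun_fubini_tonelli_G joint measurable_joint joint_ge0).
Qed.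

Lemma output_density_ge0 w : 0 <= output_density muX pX pWX w.
Proof. by apply: integral_ge0 => x _; exact: (joint_ge0 (x, w)). Qed.

Lemma integral_output_density : \int[muW]_w output_density muX pX pWX w = 1.
Proof.
rewrite -(fubini_tonelli joint measurable_joint joint_ge0).
case: dpX cpWX => mpX pX0 <- [_ dWX]; apply: eq_integral => x _.
have [mWx WX0 Wx1] := dWX x; rewrite /joint/=.
under eq_integral do rewrite EFinM.
rewrite ge0_integralZl ?Wx1 ?mule1 ?lee_fin//; first exact/measurable_EFinP.
by move=> w _; rewrite lee_fin.
Qed.

End output_density_theory.

(** * The detection bound and the small-[eps] expansion *)

Theorem corollary1 (R : realType) :
  (forall (dX dW : measure_display)
      (X : measurableType dX) (W : measurableType dW)
      (muX : {sigma_finite_measure set X -> \bar R})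
      (muW : {sigma_finite_measure set W -> \bar R})
      (pX : X -> R) (x0 : X) (pWX : X -> W -> R)
      (n : nat) (eps : R) (phi : n.-tuple W -> R),
    is_density muX pX ->
    is_channel muW pWX ->
    let p0 := fun w => (pWX x0 w)%:E in
    let pW := output_density muX pX pWX in
    dominated_density pW p0 ->
    (1 <= n)%N ->
    0 < eps < 1 ->
    let muWn := tuple_measure muW n in
    let f0 := iid_density (n := n) p0 in
    let f1 := iid_density (n := n) pW in
    optimal_test muWn f0 f1 phi ->
    (chi2 muW pW p0 <= (4 * xi eps ^+ 2 * eps ^+ 2 / n%:R)%:E)%E ->
    ((1 - eps)%:E <=
      false_detection muWn f0 phi + miss_detection muWn f1 phi)%E)
  /\
  (exists r : R -> R,
     r =O_ (0^'+) (fun eps : R => eps ^+ 4) /\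
     forall (n : nat) (eps : R), (1 <= n)%N -> 0 < eps < 1 ->
       4 * xi eps ^+ 2 * eps ^+ 2 / n%:R = n%:R^-1 * (4 * eps ^+ 2 + r eps)).
Proof.
split; last first.
  exists (fun e => lambertW0 (4 * e ^+ 2) - 4 * e ^+ 2); split.
    (* The constant 16 comes from squaring [4 * e ^+ 2] in [lambertW0_quad]; the estimate holds for
       every [e], not only near 0. *)
    apply/eqO_exP; exists 16 => //; apply: nearW => e.
    have y0 : 0 <= 4 * e ^+ 2 by rewrite mulr_ge0// sqr_ge0.
    apply: (le_trans (lambertW0_quad y0)).
    rewrite [X in _ <= _ * X]ger0_norm; last by rewrite (exprM e 2 2) sqr_ge0.
    by rewrite exprMn -exprM -natrX.
  by move=> n e n0 e01; rewrite xi_lambertW0 [RHS]mulrC addrC subrK.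
move=> dX dW X W muX muW pX x0 pWX n e phi dpX cpWX p0 pW pWp0 n0 /andP[e0 _].
move=> muWn f0 f1 [tphi _]; rewrite xi_lambertW0 => chi2_le.
have [mq q0 q1] : is_density muW (pWX x0) by case: cpWX.
have mp0 : measurable_fun setT p0 by exact/measurable_EFinP.
have p00 w : (0 <= p0 w)%E by rewrite lee_fin.
have mpW : measurable_fun setT pW by exact: (measurable_output_density dpX cpWX).
have pW0 w : (0 <= pW w)%E by exact: (output_density_ge0 dpX cpWX).
(* Its integral is the second moment of the likelihood ratio under [p0]; by domination it vanishes
   wherever [p0] does. *)
pose g w := (pW w ^+ 2 / p0 w)%E.
have mg : measurable_fun setT g.
  apply: emeasurable_funM; last exact: measurable_inve_ge0.
  by under eq_fun do rewrite expe2; exact: emeasurable_funM.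
have g0 w : (0 <= g w)%E by rewrite mule_ge0 ?sqre_ge0// inve_ge0.
have f0E : f0 = EFin \o (fun w => \prod_(i < n) pWX x0 (tnth w i)).
  by apply/funext => w /=; rewrite -prodEFin.
have y0 : 0 <= 4 * e ^+ 2 by rewrite mulr_ge0// sqr_ge0.
rewrite f0E; apply: (@chi2_error_bound _ _ _ _ _ _ (iid_density g)) => //.
- split.
  + apply/measurable_EFinP; rewrite -[X in measurable_fun _ X]f0E.
    exact: measurable_iid_density.
  + by move=> w; apply: prodr_ge0.
  + have := integral_iid_density muW n mp0 p00.
    by rewrite -/f0 f0E q1 => ->; rewrite expe1n.
- exact: measurable_iid_density.
- by move=> w; apply: prode_ge0.
- rewrite integral_iid_density// (integral_output_density dpX cpWX)//.
  by rewrite expe1n.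
- exact: measurable_iid_density.
- by move=> w; apply: prode_ge0.
(* The relation between [f1 ^+ 2], [g] and [f0] factors over the coordinates, each factor being
   [sqr_divK]. *)
- move=> w; rewrite -prodEFin /f1 /iid_density expe2 -!big_split.
  by apply: eq_bigr => i _; rewrite /= -expe2; exact: (sqr_divK (q0 _) (pW0 _) (pWp0 _)).
rewrite integral_iid_density//.
set w := lambertW0 _ in chi2_le *.
have w0 : 0 <= w by exact: lambertW0_ge0.
apply: (@le_trans _ _ (((1 + w / n%:R) ^+ n)%:E)).
  rewrite EFin_expe lee_expe2r ?integral_ge0//.
  rewrite integral_sqr_div// ?(integral_output_density dpX cpWX)//.
  by rewrite EFinD [leRHS]addeC leeD2r.
rewrite lee_fin; apply: le_trans (expR_lambertW0 y0).
exact: expr_1Ddivn_le.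
Qed.
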